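(* Let $m\ge 2$ and let $p_j=(x_j,y_j)^T\in\mathbb{R}^2$, $j=1,\ldots,m$, be points such that $x_j\neq x_k$ for all $j\neq k$. Then there exists a unique linear function $y(x)=ax+b$ ($a,b\in\mathbb{R}$) with minimal algebraic $L^2$-distance to the set $\{p_1,\ldots,p_m\}$, i.e. a unique pair $(a,b)\in\mathbb{R}^2$ at which $(a,b)\mapsto\sum_{j=1}^m (y_j-ax_j-b)^2$ attains its global minimum over $\mathbb{R}^2$. This function has slope $S_{xy}/S_{xx}$ and its graph contains the center of mass $(\bar x,\bar y)^T$ of $\{p_1,\ldots,p_m\}$, i.e. $$y(x)=\frac{S_{xy}}{S_{xx}}(x-\bar x)+\bar y.$$
   Context: Notation: $\bar x=\frac1m\sum_{j=1}^m x_j$, $\bar y=\frac1m\sum_{j=1}^m y_j$, $S_{xx}=\sum_{j=1}^m (x_j-\bar x)^2$, $S_{xy}=\sum_{j=1}^m (x_j-\bar x)(y_j-\bar y)$. ''Linear function'' means a function of the form $x\mapsto ax+b$ with $a,b\in\mathbb{R}$. *)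

(* Defs.v *)
From mathcomp Require Import all_boot all_order all_algebra.
From mathcomp Require Import reals.

Set Implicit Arguments.
Unset Strict Implicit.
Unset Printing Implicit Defensive.

Import Order.TTheory GRing.Theory Num.Theory.
Local Open Scope ring_scope.

(* Points (x_j, y_j) of R^2 are pairs; x_j is [(p j).1] and y_j is [(p j).2]. *)

Definition xmean (R : realType) (m : nat) (p : 'I_m -> R * R) : R :=
  m%:R^-1 * \sum_(j < m) (p j).1.

Definition ymean (R : realType) (m : nat) (p : 'I_m -> R * R) : R :=
  m%:R^-1 * \sum_(j < m) (p j).2.

Definition center_of_mass (R : realType) (m : nat) (p : 'I_m -> R * R) :
    R * R :=
  (xmean p, ymean p).

Definition Sxx (R : realType) (m : nat) (p : 'I_m -> R * R) : R :=
  \sum_(j < m) ((p j).1 - xmean p) ^+ 2.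

Definition Sxy (R : realType) (m : nat) (p : 'I_m -> R * R) : R :=
  \sum_(j < m) ((p j).1 - xmean p) * ((p j).2 - ymean p).

(* The function with slope [ab.1] and intercept [ab.2]. *)
Definition linear_fun (R : realType) (ab : R * R) : R -> R :=
  fun x => ab.1 * x + ab.2.

Definition on_graph (R : realType) (f : R -> R) (q : R * R) : Prop :=
  q.2 = f q.1.

(* Only vertical deviations enter, and no square root is taken. *)
Definition algebraic_dist (R : realType) (m : nat) (p : 'I_m -> R * R)
    (ab : R * R) : R :=
  \sum_(j < m) ((p j).2 - ab.1 * (p j).1 - ab.2) ^+ 2.

Definition global_minimizer (R : realType) (m : nat) (p : 'I_m -> R * R)
    (ab : R * R) : Prop :=
  forall cd : R * R, algebraic_dist p ab <= algebraic_dist p cd.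

(* Main.v *)
Require Import Defs.
From mathcomp Require Import all_boot all_order all_algebra.
From mathcomp Require Import reals.
From mathcomp Require Import ring.

(** The residuals of the line through the center of mass with slope
    [Sxy / Sxx] are orthogonal both to the constants and to the centered
    abscissas (the normal equations).  Passing to another line [a x + b] adds
    to these residuals a combination of exactly those two vectors, which are
    themselves orthogonal to each other.  By Pythagoras the objective grows by
    [Sxx (a - Sxy / Sxx)^2 + m (ybar - a xbar - b)^2]
    ([algebraic_dist_excess]).  Distinct abscissas give [0 < Sxx]
    ([Sxx_gt0]), so this excess is nonnegative and vanishes only at the
    regression line; existence, uniqueness and the formulas all follow. *)

Set Implicit Arguments.
Unset Strict Implicit.
Unset Printing Implicit Defensive.

Import Order.TTheory GRing.Theory Num.Theory.
Local Open Scope ring_scope.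

Lemma sum_sub_mean (F : numFieldType) (m : nat) (f : 'I_m -> F) :
  \sum_(j < m) (f j - m%:R^-1 * \sum_(k < m) f k) = 0.
Proof.
(* The mean of no points is [0^-1 * 0]; the identity still holds there. *)
case: m f => [|m] f; first by rewrite big_ord0.
rewrite sumrB sumr_const card_ord -(mulr_natl (_ * _)) mulrA.
by rewrite divff ?pnatr_eq0 // mul1r subrr.
Qed.

(** Two different abscissas cannot both equal the mean, so some square in the
    sum is positive. *)
Lemma Sxx_gt0 (R : realType) (m : nat) (p : 'I_m -> R * R) (j k : 'I_m) :
  (p j).1 <> (p k).1 -> 0 < Sxx p.
Proof.
move=> pjk; rewrite lt0r sumr_ge0 ?andbT => [|i _]; last exact: sqr_ge0.
apply/negP; rewrite psumr_eq0 => [/allP Sxx0|i _]; last exact: sqr_ge0.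
have xE i : (p i).1 = xmean p.
  apply/eqP; rewrite -subr_eq0 -sqrf_eq0.
  exact: (Sxx0 i (mem_index_enum i)).
by apply: pjk; rewrite !xE.
Qed.

Definition regression_line (R : realType) (m : nat) (p : 'I_m -> R * R) :
    R * R :=
  (Sxy p / Sxx p, ymean p - Sxy p / Sxx p * xmean p).

(** Completing squares around the regression line leaves no cross terms: the
    centered coordinates sum to zero, and the slope [Sxy / Sxx] cancels the
    correlation between the residuals and the centered abscissas. *)
Lemma algebraic_dist_excess (R : realType) (m : nat) (p : 'I_m -> R * R)
    (ab : R * R) : Sxx p != 0 ->
  algebraic_dist p ab = algebraic_dist p (regression_line p)
    + (Sxx p * (ab.1 - Sxy p / Sxx p) ^+ 2
       + m%:R * (ymean p - ab.1 * xmean p - ab.2) ^+ 2).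
Proof.
case: ab => a b /= Sxx_neq0; rewrite /algebraic_dist /regression_line /=.
set s := Sxy p / Sxx p; set c := ymean p - a * xmean p - b.
pose u j := (p j).1 - xmean p; pose v j := (p j).2 - ymean p.
have sum_u : \sum_(j < m) u j = 0 by exact: sum_sub_mean.
have sum_v : \sum_(j < m) v j = 0 by exact: sum_sub_mean.
(* The residual at [j] is [(v j - s * u j) + (s - a) * u j + c]; its square is
   sorted so that each sum below is known. *)
have sqrE j : ((p j).2 - a * (p j).1 - b) ^+ 2 =
    ((p j).2 - s * (p j).1 - (ymean p - s * xmean p)) ^+ 2
    + (2 * (s - a) * (u j * v j)
       + ((a - s) ^+ 2 - 2 * s * (s - a)) * u j ^+ 2
       + (2 * c * v j - 2 * c * a * u j + c ^+ 2)).
  by rewrite /u /v /c; ring.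
rewrite (eq_bigr _ (fun j _ => sqrE j)) big_split /=; congr (_ + _).
rewrite !big_split sumrN -!mulr_sumr sum_u sum_v sumr_const card_ord /=.
have -> : \sum_(j < m) u j * v j = s * Sxx p by rewrite /s divfK.
have -> : \sum_(j < m) u j ^+ 2 = Sxx p by [].
by ring.
Qed.

Theorem theorem1 (R : realType) (m : nat) (p : 'I_m -> R * R)
    (hm : (2 <= m)%N)
    (hx : forall j k : 'I_m, j <> k -> (p j).1 <> (p k).1) :
  (exists! ab : R * R, global_minimizer p ab) /\
  (forall ab : R * R, global_minimizer p ab ->
    [/\ ab.1 = Sxy p / Sxx p,
        on_graph (linear_fun ab) (center_of_mass p) &
        forall x : R,
          linear_fun ab x = Sxy p / Sxx p * (x - xmean p) + ymean p]).
Proof.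
have m_gt0 : 0 < m%:R :> R by rewrite ltr0n ltnW.
have Sxx0 : 0 < Sxx p.
  by apply: (@Sxx_gt0 _ _ p (Ordinal (ltnW hm)) (Ordinal hm)); apply: hx.
have excess ab := @algebraic_dist_excess _ _ p ab (lt0r_neq0 Sxx0).
have reg_min : global_minimizer p (regression_line p).
  move=> cd; rewrite (excess cd) lerDl.
  by rewrite addr_ge0 // mulr_ge0 ?sqr_ge0 ?ltW.
have min_uniq ab : global_minimizer p ab -> ab = regression_line p.
  move=> /(_ (regression_line p)); rewrite (excess ab) gerDl => le0.
  have ge1 : 0 <= Sxx p * (ab.1 - Sxy p / Sxx p) ^+ 2.
    by rewrite mulr_ge0 ?sqr_ge0 ?ltW.
  have ge2 : 0 <= m%:R * (ymean p - ab.1 * xmean p - ab.2) ^+ 2.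
    by rewrite mulr_ge0 ?sqr_ge0 ?ltW.
  have : Sxx p * (ab.1 - Sxy p / Sxx p) ^+ 2
         + m%:R * (ymean p - ab.1 * xmean p - ab.2) ^+ 2 == 0.
    by rewrite eq_le le0 addr_ge0.
  rewrite paddr_eq0 // (mulf_eq0 (Sxx p)) (mulf_eq0 m%:R) !sqrf_eq0.
  rewrite (gt_eqF Sxx0) (gt_eqF m_gt0) /= !subr_eq0.
  by case: ab {le0 ge1 ge2} => a b /= /andP[/eqP -> /eqP <-].
split; first by exists (regression_line p); split=> // ab /min_uniq.
move=> ab /min_uniq ->; rewrite /on_graph /linear_fun /=.
by split=> // [|x]; ring.
Qed.
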